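(* Let $q>0$, $q\ne1$, $M\ge1$, $\vec N=(N_1,\dots,N_M)\in(\mathbb{Z}_{\ge0})^M$, $s,t,v\in\mathbb{C}$, and $\vec x,\vec y\in\prod_{j=1}^M\{0,\dots,N_j\}$. Then the multivariate overlap coefficient $R_{\mathrm r}(\vec x,\vec y)=R_{\mathrm r}(\vec x,\vec y;s,t,v,\vec N;q)$ is the nested product of univariate functions $$R_{\mathrm r}(\vec x,\vec y)=\prod_{j=1}^M R_{\mathrm r}\big(x_j,y_j;\,h_{j-1}(\vec x,s),\,h_{j-1}(\vec y,t),\,v,\,N_j;\,q\big).$$
   Context: $q^z=e^{z\log q}$; $(\alpha;p)_n=\prod_{i=0}^{n-1}(1-\alpha p^i)$, $(\alpha_1,\dots,\alpha_m;p)_n=\prod_i(\alpha_i;p)_n$; $\begin{bmatrix}N\\ n\end{bmatrix}_{p}=\frac{(p;p)_N}{(p;p)_n(p;p)_{N-n}}$. Univariate functions: for $N\in\mathbb{Z}_{\ge0}$, $u,s\in\mathbb{C}$, $n,x,y\in\{0,\dots,N\}$, $$k_{u,s}(n,x;N)=(-1)^nq^{n(s-u-\frac12N+\frac12)}\sum_{j=0}^{\min(n,x)}\frac{(q^{2n},\,q^{2x},\,-q^{-2x-2s+2N};q^{-2})_j}{(q^{2N},\,q^{-2};q^{-2})_j}q^{-2j},\qquad w(n;N)=q^{n(n-N)}\begin{bmatrix}N\\ n\end{bmatrix}_{q^2},$$ $$R_{\mathrm r}(x,y;s,t,v,N;q)=\sum_{n=0}^N k_{1,s}(n,x;N)\,k_{v,t}(n,y;N)\,w(n;N).$$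 Height function: $h_j(\vec y,t)=t+\sum_{i=1}^j(2y_i-N_i)$, $h_0(\vec y,t)=t$. Multivariate functions: $$K_{v,t}(\vec n,\vec y)=\prod_{j=1}^M k_{v,h_{j-1}(\vec y,t)}(n_j,y_j;N_j),\qquad w(\vec n)=\prod_{j=1}^Mw(n_j;N_j),$$ $$R_{\mathrm r}(\vec x,\vec y;s,t,v,\vec N;q)=\sum_{n_1=0}^{N_1}\cdots\sum_{n_M=0}^{N_M}K_{1,s}(\vec n,\vec x)\,K_{v,t}(\vec n,\vec y)\,w(\vec n).$$ *)

(* Defs.v *)
From HB Require Import structures.
From mathcomp Require Import all_boot all_order all_algebra.
From mathcomp Require Import complex.
From mathcomp Require Import all_classical all_reals all_analysis.

Set Implicit Arguments.
Unset Strict Implicit.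
Unset Printing Implicit Defensive.

Import Order.TTheory GRing.Theory Num.Theory.
Local Open Scope ring_scope.
Local Open Scope complex_scope.

Definition cexp (R : realType) (z : R[i]) : R[i] :=
  (expR (complex.Re z))%:C * (cos (complex.Im z) +i* sin (complex.Im z)).

Definition cpow (R : realType) (q : R) (z : R[i]) : R[i] :=
  cexp (z * (ln q)%:C).

Definition qpoch (F : fieldType) (a p : F) (n : nat) : F :=
  \prod_(i < n) (1 - a * p ^+ i).

Definition qpochs (F : fieldType) (s : seq F) (p : F) (n : nat) : F :=
  \prod_(a <- s) qpoch a p n.

(* Only meaningful for n <= N, since N - n is truncated. *)
Definition qbinom (F : fieldType) (N n : nat) (p : F) : F :=
  qpoch p p N / (qpoch p p n * qpoch p p (N - n)).

Definition kfun (R : realType) (q : R) (u s : R[i]) (n x N : nat) : R[i] :=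
  (-1) ^+ n * cpow q (n%:R * (s - u - N%:R / 2 + 1 / 2)) *
  \sum_(j < (minn n x).+1)
    qpochs [:: cpow q (2 * n%:R);
               cpow q (2 * x%:R);
               - cpow q (- (2 * x%:R) - 2 * s + 2 * N%:R)]
           (cpow q (- 2)) j
    / qpochs [:: cpow q (2 * N%:R); cpow q (- 2)] (cpow q (- 2)) j
    * cpow q (- (2 * j%:R)).

Definition wfun (R : realType) (q : R) (n N : nat) : R[i] :=
  cpow q (n%:R * (n%:R - N%:R)) * qbinom N n (cpow q 2).

Definition Rr (R : realType) (x y : nat) (s t v : R[i]) (N : nat) (q : R)
    : R[i] :=
  \sum_(n < N.+1) kfun q 1 s n x N * kfun q v t n y N * wfun q n N.

(* Components are numbered from 0: j : 'I_M is the component j + 1 of the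
   usual 1-based numbering. *)
Definition multiidx (M : nat) (N : 'I_M -> nat) : Type :=
  {dffun forall j : 'I_M, 'I_(N j).+1}.

(* h_j; since components are 0-based, the parameter h_{j-1} of the usual
   1-based component j is height y t j for the corresponding j : 'I_M. *)
Definition height (R : realType) (M : nat) (N : 'I_M -> nat)
    (y : multiidx N) (t : R[i]) (j : nat) : R[i] :=
  t + \sum_(i < M | (i < j)%N) (2 * (y i)%:R - (N i)%:R).

Definition Kfun (R : realType) (q : R) (M : nat) (N : 'I_M -> nat)
    (v t : R[i]) (n y : multiidx N) : R[i] :=
  \prod_(j < M) kfun q v (height y t j) (n j) (y j) (N j).

Definition wmulti (R : realType) (q : R) (M : nat) (N : 'I_M -> nat)
    (n : multiidx N) : R[i] :=
  \prod_(j < M) wfun q (n j) (N j).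

Definition Rrmulti (R : realType) (M : nat) (N : 'I_M -> nat)
    (x y : multiidx N) (s t v : R[i]) (q : R) : R[i] :=
  \sum_(n : {dffun forall j : 'I_M, 'I_(N j).+1})
    Kfun q 1 s n x * Kfun q v t n y * wmulti q n.

(* Main.v *)
(* The parameter height _ _ j depends only on the fixed multi-indices x and y,
   not on the summation variable n.  Hence the summand is a product over j of
   terms depending on n only through n j, and the multiple sum factors by
   distributivity. *)

Require Import Defs.
From mathcomp Require Import all_boot all_order all_algebra.
From mathcomp Require Import complex.
From mathcomp Require Import all_classical all_reals all_analysis.

Import Order.TTheory GRing.Theory Num.Theory.
Local Open Scope ring_scope.
Local Open Scope complex_scope.

(** Ordinary distributivity uses one index type for all factors, so each [T i] is embedded in the
    sigma type of the family [T]; a dependent choice becomes a plain function whose value at [i] has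
    tag [i]. *)
Lemma prodr_sum_dffun (A : comPzSemiRingType) (I : finType) (T : I -> finType)
    (F : forall i : I, T i -> A) :
  \prod_(i : I) \sum_(k : T i) F i k =
  \sum_(f : {dffun forall i : I, T i}) \prod_(i : I) F i (f i).
Proof.
pose P i : {ffun T i -> A} := [ffun k => F i k].
rewrite (reindex (@dffun_of_fprod _ T)); last first.
  exact/onW_bij/dffun_of_fprod_bij.
transitivity (\sum_(t : fprod T) \prod_(i in I) P i (t i)); last first.
  by apply: eq_bigr => t _; apply: eq_bigr => i _; rewrite !ffunE.
rewrite big_fprod.
(* The default 0 of [untag] is never taken: the sums range only over elements with tag [i]. *)
rewrite -(bigA_distr_big_dep (fun i => tagged_with T i)
            (fun i => untag 0 (P i))).
apply: eq_bigr => i _; rewrite -(big_tag (fun i k => P i k)).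
by apply: eq_bigr => k _; rewrite ffunE.
Qed.

Theorem corollary3p13 (R : realType) (q : R) (hq0 : 0 < q) (hq1 : q != 1)
    (M : nat) (hM : (1 <= M)%N) (N : 'I_M -> nat) (s t v : R[i])
    (x y : multiidx N) :
  Rrmulti x y s t v q =
  \prod_(j < M)
    Rr (x j) (y j) (height x s j) (height y t j) v (N j) q.
Proof.
rewrite /Rr prodr_sum_dffun.
(* For fixed [n], a product of triple products is regrouped into three products over [j]. *)
by apply: eq_bigr => n _; rewrite /Kfun /wmulti !big_split.
Qed.
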